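(* Let $\boldsymbol{\ell}, \boldsymbol{c} : \mathbb{N} \to \mathbb{N} \cup \{\infty\}$ be non-decreasing, let $d \in \mathbb{N}$ and $\alpha \in (0,\infty)$ be arbitrary, and suppose that $\gamma^\sharp(\boldsymbol{\ell},\boldsymbol{c}) < \infty$. Let $U := U^{\alpha,\infty}_{\boldsymbol{\ell},\boldsymbol{c},\varrho_2}([0,1]^d)$ be the unit ball of the ReQU approximation space $A^{\alpha,\infty}_{\boldsymbol{\ell},\boldsymbol{c},\varrho_2}([0,1]^d)$ and let $\iota_\infty : A^{\alpha,\infty}_{\boldsymbol{\ell},\boldsymbol{c},\varrho_2}([0,1]^d) \to C([0,1]^d)$ be the embedding $u \mapsto u$. Then $$ err^{\mathrm{det}}(U, \iota_\infty) \geq \frac{\alpha}{d\,(\alpha + \gamma^\sharp(\boldsymbol{\ell},\boldsymbol{c}))} \qquad\text{and}\qquad err^{\mathrm{MC}}(U, \iota_\infty) \geq \frac{\alpha}{d\,(\alpha + \gamma^\sharp(\boldsymbol{\ell},\boldsymbol{c}))} . $$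
   Context: $\mathbb{N} = \{1,2,3,\dots\}$. Neural networks. A neural network with $L$ layers is a sequence $\Phi = ((A_1,b_1),\dots,(A_L,b_L))$ with $A_j \in \mathbb{R}^{N_j \times N_{j-1}}$, $b_j \in \mathbb{R}^{N_j}$, $N_0,\dots,N_L \in \mathbb{N}$. Put $L(\Phi) = L$, $d_{\mathrm{in}}(\Phi) = N_0$, $d_{\mathrm{out}}(\Phi) = N_L$, $W(\Phi) = \sum_{j=1}^L (\|A_j\|_{\ell^0} + \|b_j\|_{\ell^0})$ where $\|\cdot\|_{\ell^0}$ counts nonzero entries, and $\|\Phi\|_{\mathcal{NN}} = \max_j \max\{\|A_j\|_\infty, \|b_j\|_\infty\}$ where $\|\cdot\|_\infty$ is the largest absolute value of an entry. The activation function is the ReQU $\varrho_2(x) = \max(0,x)^2$, applied componentwise to vectors, and the realization is $R_{\varrho_2}\Phi = T_L \circ (\varrho_2 \circ T_{L-1}) \circ \cdots \circ (\varrho_2 \circ T_1) : \mathbb{R}^{N_0} \to \mathbb{R}^{N_L}$ with $T_j x = A_j x + b_j$. For $n \in \mathbb{N}$, let $\Sigma_n^{\boldsymbol{\ell},\boldsymbol{c},\varrho_2}$ be the set of all $R_{\varrho_2}\Phi$ where $d_{\mathrm{in}}(\Phi) = d$, $d_{\mathrm{out}}(\Phi) = 1$, $W(\Phi) \leq n$, $L(\Phi) \leq \boldsymbol{\ell}(n)$, $\|\Phi\|_{\mathcal{NN}} \leq \boldsymbol{c}(n)$. With $\boldsymbol{\ell}^\ast := \sup_{n} \boldsymbol{\ell}(n)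 \in \mathbb{N} \cup \{\infty\}$ and $\mathbb{N}_{\leq \boldsymbol{\ell}^\ast} = \{L \in \mathbb{N} : L \leq \boldsymbol{\ell}^\ast\}$, $$\gamma^\sharp(\boldsymbol{\ell},\boldsymbol{c}) := \inf\bigl\{\gamma \geq 0 : \exists C > 0\ \forall n \in \mathbb{N},\, L \in \mathbb{N}_{\leq \boldsymbol{\ell}^\ast}:\ \boldsymbol{c}(n)^{2^L - 1} \cdot n^{(2^L - 1)/2} \leq C\, n^\gamma \bigr\} \in [0,\infty].$$ Approximation space. For measurable $u : [0,1]^d \to \mathbb{R}$ let $$\Gamma(u) := \max\Bigl\{ \|u\|_{L^\infty([0,1]^d)},\ \sup_{n \in \mathbb{N}} \bigl[ n^\alpha \cdot \inf_{g \in \Sigma_n^{\boldsymbol{\ell},\boldsymbol{c},\varrho_2}} \|u - g\|_{L^\infty([0,1]^d)} \bigr] \Bigr\} \in [0,\infty],$$ $\|u\|_{A^{\alpha,\infty}_{\boldsymbol{\ell},\boldsymbol{c},\varrho_2}} := \inf\{t > 0 : \Gamma(u/t) \leq 1\}$, and let $A^{\alpha,\infty}_{\boldsymbol{\ell},\boldsymbol{c},\varrho_2}([0,1]^d)$ be the set of $u \in L^\infty([0,1]^d)$ for which this is finite. Its elements are (identified with) continuous functions on $[0,1]^d$. $U^{\alpha,\infty}_{\boldsymbol{\ell},\boldsymbol{c},\varrho_2}([0,1]^d)$ is the set of $u$ in this space with $\|u\|_{A^{\alpha,\infty}_{\boldsymbol{\ell},\boldsymbol{c},\varrho_2}} \leq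 1$, regarded as a subset of $C([0,1]^d)$, which carries the uniform norm. Optimal orders. Let $\varnothing \neq U \subset C([0,1]^d)$ be bounded, $Y$ a Banach space, $S : U \to Y$. $\mathrm{Alg}_m(U,Y)$ is the set of maps $A : U \to Y$ for which there exist $x_1,\dots,x_m \in [0,1]^d$ and a map $Q : \mathbb{R}^m \to Y$ with $A(u) = Q(u(x_1),\dots,u(x_m))$ for all $u \in U$. Put $e_m^{\mathrm{det}}(U,S) := \inf_{A \in \mathrm{Alg}_m(U,Y)} \sup_{u \in U} \|A(u) - S(u)\|_Y$ and $$err^{\mathrm{det}}(U,S) := \sup\{\beta \geq 0 : \exists C > 0\ \forall m \in \mathbb{N}:\ e_m^{\mathrm{det}}(U,S) \leq C\, m^{-\beta}\}.$$ $\mathrm{Alg}^{\mathrm{MC}}_m(U,Y)$ is the class of pairs $(\boldsymbol{A},\boldsymbol{m})$ where $\boldsymbol{A} = (A_\omega)_{\omega \in \Omega}$ is a family of maps $A_\omega : U \to Y$ indexed by a probability space $(\Omega,\mathcal{F},\mathbb{P})$ and $\boldsymbol{m} : \Omega \to \mathbb{N}$ is measurable with $\mathbb{E}[\boldsymbol{m}] \leq m$, such that $\omega \mapsto A_\omega(u)$ is measurable (Borel $\sigma$-algebra on $Y$) for each $u \in U$ and $A_\omega \in \mathrm{Alg}_{\boldsymbol{m}(\omega)}(U,Y)$ for each $\omega$. Put $e_m^{\mathrm{MC}}(U,S) := \inf_{(\boldsymbol{A},\boldsymbol{m}) \in \mathrm{Alg}^{\mathrm{MC}}_m(U,Y)}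 \sup_{u \in U} \mathbb{E}_\omega[\|S(u) - A_\omega(u)\|_Y]$ and $$err^{\mathrm{MC}}(U,S) := \sup\{\beta \geq 0 : \exists C > 0\ \forall m \in \mathbb{N}:\ e_m^{\mathrm{MC}}(U,S) \leq C\, m^{-\beta}\}.$$ Here $Y = C([0,1]^d)$ and $S = \iota_\infty$ restricted to $U$. *)

(* Defs.v *)
From HB Require Import structures.
From mathcomp Require Import all_boot all_order all_algebra.
From mathcomp Require Import all_classical all_reals all_analysis.
From mathcomp Require Import ring lra.

Set Implicit Arguments.
Unset Strict Implicit.
Unset Printing Implicit Defensive.

Import Order.TTheory GRing.Theory Num.Theory.
Import numFieldNormedType.Exports.

Local Open Scope classical_set_scope.
Local Open Scope ring_scope.

Definition measure_mx_display : measure_display -> measure_display.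
Proof. exact. Qed.

(* Matrices carry the product sigma-algebra, generated by the entries (the
   library has this for tuples only). *)
Section measurable_matrix.
Context {disp : measure_display} {T : sigmaRingType disp} {m n : nat}.

Definition mx_entry (ij : 'I_m * 'I_n) (A : 'M[T]_(m, n)) : T := A ij.1 ij.2.

Definition mx_measurable : set (set 'M[T]_(m, n)) :=
  <<s \bigcup_ij preimage_set_system setT (mx_entry ij) measurable >>.

Let mx_set0 : mx_measurable set0.
Proof. exact: sigma_algebra0. Qed.

Let mx_setC A : mx_measurable A -> mx_measurable (~` A).
Proof. exact: sigma_algebraC. Qed.

Let mx_bigcup (F : (set 'M[T]_(m, n))^nat) :
  (forall i, mx_measurable (F i)) -> mx_measurable (\bigcup_i F i).
Proof. exact: sigma_algebra_bigcup. Qed.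

HB.instance Definition _ := @isMeasurable.Build (measure_mx_display disp)
  'M[T]_(m, n) mx_measurable mx_set0 mx_setC mx_bigcup.

End measurable_matrix.

Lemma measurable_mx_entry (disp : measure_display) (T : sigmaRingType disp)
    (m n : nat) (ij : 'I_m * 'I_n) :
  measurable_fun setT (mx_entry ij : 'M[T]_(m, n) -> T).
Proof.
move=> _ Y mY; rewrite setTI; apply: sub_sigma_algebra.
by exists ij => //; exists Y => //; rewrite setTI.
Qed.

Lemma measurable_fun_mxP (disp1 disp2 : measure_display)
    (T1 : measurableType disp1) (T2 : measurableType disp2) (m n : nat)
    (f : T1 -> 'M[T2]_(m, n)) :
  measurable_fun setT f <->
  forall i j, measurable_fun setT (fun x => f x i j).
Proof.
split=> [mf i j|mf].
  by apply: (measurableT_comp (measurable_mx_entry (i, j)) mf).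
apply: (@measurability _ _ _ _ _ _
  (\bigcup_ij preimage_set_system setT (@mx_entry _ T2 m n ij) measurable)) => //.
move=> _ [_ [ij _ [B mB <-]] <-].
rewrite !setTI -comp_preimage -[X in measurable X]setTI.
exact: (mf ij.1 ij.2).
Qed.

(* Lebesgue measure on the Borel sets of R^n, as an iterated product:
   lebesgue_vec n.+1 is the image of (lebesgue on R) \x (lebesgue_vec n) under
   the identification R x R^n = R^(1 + n). *)
Section lebesgue_step.
Context {R : realType} {n : nat}.
Variable mu : {sigma_finite_measure set 'cV[R]_n -> \bar R}.

Definition vec_cons (xv : measurableTypeR R * 'cV[R]_n) : 'cV[R]_n.+1 :=
  col_mx (xv.1 : R)%:M xv.2.

Definition vec_uncons (v : 'cV[R]_n.+1) : measurableTypeR R * 'cV[R]_n :=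
  ((v : 'cV_(1 + n)) 0 0, dsubmx (v : 'cV_(1 + n))).

Lemma vec_consK : cancel vec_cons vec_uncons.
Proof.
move=> [x v]; rewrite /vec_cons /vec_uncons/= col_mxKd; congr pair.
rewrite mxE; case: splitP => [j _|k] //=.
by rewrite mxE ord1 eqxx mulr1n.
Qed.

Lemma measurable_vec_cons : measurable_fun setT vec_cons.
Proof.
apply/measurable_fun_mxP => i j; rewrite /vec_cons.
have [k ->|k ->] := @split_ordP 1 n i.
  rewrite (_ : (fun _ => _) = fst); first exact: measurable_fst.
  by apply/funext => xv; rewrite [LHS]col_mxEu mxE !ord1 eqxx mulr1n.
rewrite (_ : (fun _ => _) = mx_entry (k, j) \o snd).
  exact: measurableT_comp (measurable_mx_entry (k, j)) measurable_snd.
by apply/funext => xv; rewrite [LHS]col_mxEd.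
Qed.

Lemma measurable_vec_uncons : measurable_fun setT vec_uncons.
Proof.
apply/measurable_fun_pairP; split.
  exact: (@measurable_mx_entry _ R n.+1 1 (0, 0)).
apply/measurable_fun_mxP => i j /=.
under eq_fun do rewrite mxE.
exact: (@measurable_mx_entry _ R n.+1 1 (_, j)).
Qed.

Definition lebesgue_step : set 'cV[R]_n.+1 -> \bar R :=
  pushforward (@lebesgue_measure R \x mu)%E vec_cons.

Let lebesgue_step0 : lebesgue_step set0 = 0%E.
Proof. by rewrite /lebesgue_step /pushforward preimage_set0 measure0. Qed.

Let lebesgue_step_ge0 A : (0 <= lebesgue_step A)%E.
Proof. exact: (measure_ge0 (@lebesgue_measure R \x mu)%E). Qed.

Let lebesgue_step_additive : semi_sigma_additive lebesgue_step.
Proof.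
have mpre A : measurable A -> measurable (vec_cons @^-1` A).
  by move=> mA; rewrite -[X in measurable X]setTI; exact: measurable_vec_cons.
move=> F mF tF mUF; rewrite /lebesgue_step /pushforward preimage_bigcup.
apply: measure_semi_sigma_additive; first by move=> k; exact: mpre.
- apply/trivIsetP => /= i j _ _ ij; rewrite -preimage_setI.
  by move/trivIsetP : tF => /(_ _ _ _ _ ij) ->//; rewrite preimage_set0.
- by rewrite -preimage_bigcup; exact: mpre.
Qed.

HB.instance Definition _ := isMeasure.Build _ _ _ lebesgue_step
  lebesgue_step0 lebesgue_step_ge0 lebesgue_step_additive.

Let lebesgue_step_sigma_finite : sigma_finite setT lebesgue_step.
Proof.
have /sigma_finiteP[F [TF ndF mF]] := sigma_finiteT (@lebesgue_measure R).
have /sigma_finiteP[G [TG ndG mG]] := sigma_finiteT mu.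
exists (fun k => vec_uncons @^-1` (F k `*` G k)).
  rewrite -preimage_bigcup -(preimage_setT vec_uncons); congr (_ @^-1` _).
  rewrite -setXTT TF TG predeqE => -[x y]; split.
    move=> [/= [k _ Fkx] [l _ Gly]]; exists (maxn k l) => //; split.
    - by move: x Fkx; exact/subsetPset/ndF/leq_maxl.
    - by move: y Gly; exact/subsetPset/ndG/leq_maxr.
  by move=> [k _ []/= ? ?]; split; exists k.
move=> k; have [mFk Fk] := mF k; have [mGk Gk] := mG k; split.
  by rewrite -[X in measurable X]setTI; apply: measurable_vec_uncons => //;
    exact: measurableX.
rewrite /lebesgue_step /pushforward -comp_preimage.
rewrite (_ : vec_uncons \o vec_cons = id); last exact/funext/vec_consK.
by rewrite preimage_id product_measure1E// lte_mul_pinfty// ge0_fin_numE.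
Qed.

HB.instance Definition _ := Measure_isSigmaFinite.Build _ _ _ lebesgue_step
  lebesgue_step_sigma_finite.

End lebesgue_step.

Fixpoint lebesgue_vec {R : realType} (n : nat) :
    {sigma_finite_measure set 'cV[R]_n -> \bar R} :=
  match n with
  | 0 => \d_(0 : 'cV[R]_0)
  | n'.+1 => lebesgue_step (lebesgue_vec n')
  end.

Definition cube {R : realType} (d : nat) : set 'cV[R]_d :=
  [set x | forall i, 0 <= x i 0 <= 1].
Arguments cube {R} d _.

Lemma cube_compact (R : realType) (d : nat) : compact (@cube R d).
Proof.
have cT : continuous (trmx : 'rV[R]_d -> 'cV[R]_d).
  move=> x; apply/(@cvgrPdist_lt _ _ _ (nbhs x) (nbhs_filter x)) => e e0.
  have nT (y : 'rV[R]_d) : `|y^T| <= `|y|.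
    rewrite [leLHS]mx_normrE; apply: bigmax_le => // -[i j] _ /=.
    rewrite mxE [leRHS]mx_normrE.
    exact: (le_bigmax _ (fun ij : 'I_1 * 'I_d => `|y ij.1 ij.2|) (j, i)).
  apply: (@filterS _ (nbhs x) _ (ball x e)); last exact: nbhsx_ballx.
  by move=> y; rewrite -ball_normE /= -linearB; exact/le_lt_trans/nT.
rewrite (_ : cube d = trmx @` [set v : 'rV[R]_d | forall i, `[0, 1]%classic (v ord0 i)]).
  apply: continuous_compact; first exact: continuous_subspaceT.
  apply: (@rV_compact R d (fun=> `[0, 1]%classic)) => i; exact: segment_compact.
apply/seteqP; split=> [x x01|_ [v v01 <-] i].
  exists x^T; last exact: trmxK.
  by move=> i; rewrite mxE /= in_itv /=; exact: x01.
by move: (v01 i); rewrite mxE /= in_itv.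
Qed.

Lemma cube_measurable (R : realType) (d : nat) : measurable (@cube R d).
Proof.
rewrite (_ : cube d = \bigcap_(i in [set: 'I_d]) 
      (fun x : 'cV[R]_d => mx_entry (i, 0) x : R) @^-1` `[0, 1]%classic).
  apply: fin_bigcap_measurable => [|i _]; first exact: finite_finset.
  rewrite -[X in measurable X]setTI.
  by apply: measurable_mx_entry => //; exact: measurable_itv.
by apply/seteqP; split=> [x x01 i _|x x01 i];
  [rewrite /= in_itv /=; exact: x01|have := x01 i I; rewrite /= in_itv].
Qed.

Definition cube_measure {R : realType} (d : nat) :
    {measure set 'cV[R]_d -> \bar R} :=
  mrestr (lebesgue_vec d) (@cube_measurable R d).
Arguments cube_measure {R} d.

(* The Banach space C([0,1]^d) with the uniform norm: a continuous function on
   the cube is represented by its extension by 0 to R^d, so that equality of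
   representatives is equality on the cube. *)
Section continuous_functions.
Context {R : realType} {d : nat}.

Definition cts_on_cube : {pred 'cV[R]_d -> R} :=
  mem [set f : 'cV[R]_d -> R |
    {within cube d, continuous f} /\ forall x, ~ cube d x -> f x = 0].

Record ccube := CCube {
  ccube_fun :> 'cV[R]_d -> R;
  ccube_subproof : ccube_fun \in cts_on_cube }.

HB.instance Definition _ := [isSub for ccube_fun].
HB.instance Definition _ := gen_eqMixin ccube.
HB.instance Definition _ := gen_choiceMixin ccube.

Lemma cts_on_cube_submod : submod_closed cts_on_cube.
Proof.
split=> [|a f g /set_mem[cf f0] /set_mem[cg g0]]; apply/mem_set.
  by split=> // x; exact: cst_continuous.
split=> [|x nx]; last by rewrite !fctE f0// g0// scaler0 addr0.
apply: (@within_continuousD _ _ R^o) => // x.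
by apply: (@continuousZl_tmp _ R^o); exact: cf.
Qed.
HB.instance Definition _ :=
  GRing.isSubmodClosed.Build R ('cV[R]_d -> R) cts_on_cube cts_on_cube_submod.
HB.instance Definition _ := [SubChoice_isSubLmodule of ccube by <:].

Lemma ccube_cts (f : ccube) : {within cube d, continuous f}.
Proof. by have /set_mem[] := ccube_subproof f. Qed.

Lemma ccube_out (f : ccube) x : ~ cube d x -> f x = 0.
Proof. by have /set_mem[_] := ccube_subproof f; exact. Qed.

Lemma ccubeP (f g : ccube) : (forall x, cube d x -> f x = g x) -> f = g.
Proof.
move=> fg; apply/val_inj/funext => x /=.
by have [/fg//|nx] := pselect (cube d x); rewrite !ccube_out.
Qed.

Definition ccube_norm (f : ccube) : R := sup [set `|f x| | x in cube d].

Lemma cube0 : cube d (0 : 'cV[R]_d).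
Proof. by move=> i; rewrite mxE lexx ler01. Qed.

Lemma ccube_has_sup (f : ccube) : has_sup [set `|f x| | x in cube d].
Proof.
split; first by exists `|f 0|, 0 => //; exact: cube0.
have := continuous_compact (@ccube_cts f) (@cube_compact R d).
move=> /compact_bounded[M [_ fM]]; exists (M + 1) => _ [x x01 <-].
by apply: (fM (M + 1)); [rewrite ltrDl|exists x].
Qed.

Lemma ccube_norm_ge (f : ccube) x : `|f x| <= ccube_norm f.
Proof.
have supf := ccube_has_sup f.
have [x01|nx] := pselect (cube d x).
  by apply: ub_le_sup; [case: supf|exists x].
rewrite ccube_out// normr0; apply: le_trans (normr_ge0 (f 0)) _.
by apply: ub_le_sup; [case: supf|exists 0 => //; exact: cube0].
Qed.

Lemma ccube_norm_le (f : ccube) c :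
  (forall x, cube d x -> `|f x| <= c) -> ccube_norm f <= c.
Proof.
move=> fc; apply: ge_sup; first by case: (ccube_has_sup f).
by move=> _ [x x01 <-]; exact: fc.
Qed.

Let ler_ccube_normD f g : ccube_norm (f + g) <= ccube_norm f + ccube_norm g.
Proof.
apply: ccube_norm_le => x _; apply: le_trans (ler_normD (f x) (g x)) _.
by apply: lerD; exact: ccube_norm_ge.
Qed.

Let ccube_normZ (a : R) f : ccube_norm (a *: f) = `|a| * ccube_norm f.
Proof.
have Zle b g : ccube_norm (b *: g) <= `|b| * ccube_norm g.
  apply: ccube_norm_le => x _; rewrite -[leLHS]/`|b * g x| normrM.
  by rewrite ler_wpM2l// ccube_norm_ge.
apply/eqP; rewrite eq_le Zle/=.
have [->|a0] := eqVneq a 0.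
  rewrite normr0 mul0r scale0r.
  exact: le_trans (normr_ge0 _) (ccube_norm_ge 0 0).
rewrite -ler_pdivlMl ?normr_gt0// -normfV.
by rewrite -{1}(scale1r f) -(mulVf a0) -scalerA Zle.
Qed.

Let ccube_norm_eq0 f : ccube_norm f = 0 -> f = 0.
Proof.
move=> f0; apply: ccubeP => x _; apply/eqP; rewrite -normr_le0 -f0.
exact: ccube_norm_ge.
Qed.

HB.instance Definition _ :=
  Lmodule_isNormed.Build R ccube ler_ccube_normD ccube_normZ ccube_norm_eq0.

Lemma ccube_normE (f : ccube) : `|f| = sup [set `|f x| | x in cube d].
Proof. by []. Qed.

Let ccube_complete (F : set_system ccube) :
  ProperFilter F -> cauchy F -> cvg F.
Proof.
move=> FF Fc.
pose g x := lim ((fun f : ccube => f x) @ F) : R.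
have Fball (e : R) : 0 < e -> \forall f & h \near F,
    forall x, `|(f : ccube) x - (h : ccube) x| < e.
  move=> e0; have /cauchy_ballP/(_ e e0) := Fc.
  apply: filterS => -[f h] /=; rewrite -ball_normE/= => fh x.
  exact: le_lt_trans (ccube_norm_ge (f - h) x) fh.
have Fg x : (fun f : ccube => f x) @ F --> g x.
  apply: cauchy_cvg; apply/cauchy_ballP => e e0.
  rewrite near_map2.
  by apply: filterS (Fball e e0) => -[f h] /= /(_ x); rewrite -ball_normE.
have Fgu (e : R) : 0 < e ->
    \forall f \near F, forall x, `|g x - (f : ccube) x| <= e.
  move=> e0; have e20 : 0 < e / 2 by rewrite divr_gt0.
  near=> f => x.
  have fh : \forall h \near F, forall x, `|f x - (h : ccube) x| < e / 2.
    by near: f; apply: nearP_dep; exact: Fball.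
  near F => h.
  have gh : `|g x - h x| < e / 2.
    by near: h; move/cvgrPdist_lt : (Fg x); exact.
  have fhx : `|f x - h x| < e / 2.
    by near: h; apply: filterS fh => h; exact.
  apply/ltW; rewrite [e]splitr (le_lt_trans _ (ltrD gh fhx))//.
  by rewrite -[X in _ <= _ + X]normrN; apply: le_trans (ler_normD _ _); rewrite opprB addrA subrK.
have gcts : {within cube d, continuous g}.
  move=> x; apply/(@cvgrPdist_lt _ _ _ (nbhs x)) => e e0.
  have e30 : 0 < e / 3 by rewrite divr_gt0.
  near F => f.
  have gf y : `|g y - f y| <= e / 3 by move: y; near: f; exact: Fgu.
  have /(@cvgrPdist_lt _ _ _ (nbhs x))/(_ _ e30) := @ccube_cts f x.
  apply: filterS => y /= fxy.
  rewrite (_ : g x - g y = (g x - f x) + (f x - f y) + (f y - g y)); last first.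
    by rewrite !addrA !subrK.
  rewrite (_ : e = e / 3 + e / 3 + e / 3); last by field.
  apply: le_lt_trans (ler_normD _ _) _; apply: ltr_leD; last by rewrite distrC.
  by apply: le_lt_trans (ler_normD _ _) _; apply: ler_ltD.
have gout x : ~ cube d x -> g x = 0.
  move=> nx; apply/(cvg_unique _ (Fg x)) => //.
  rewrite (_ : (fun f : ccube => f x) = cst 0); first exact: cvg_cst.
  by apply/funext => f; exact: ccube_out.
have gP : g \in cts_on_cube by exact/mem_set.
apply/cvg_ex; exists (CCube gP); apply/(@cvgrPdist_le _ _ _ F) => e e0.
apply: filterS (Fgu e e0) => f gf; apply: ccube_norm_le => x _; exact: gf.
Unshelve. all: by end_near. Qed.

HB.instance Definition _ := Uniform_isComplete.Build ccube ccube_complete.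

End continuous_functions.
Arguments ccube R d : clear implicits.

(* N u {oo}, with N = {1, 2, ...}. *)
Definition Nbar {R : realType} : set (\bar R) :=
  [set x | x = +oo%E \/ exists2 k : nat, (0 < k)%N & x = k%:R%:E].

(* nn R N0 NL: nonempty sequences of layers (A, b), input layer first, with
   input dimension N0, output dimension NL and nonzero hidden dimensions. *)
Inductive nn (R : realType) : nat -> nat -> Type :=
| nn_output (p q : nat) (A : 'M[R]_(q, p)) (b : 'cV[R]_q) : nn R p q
| nn_hidden (p k q : nat) (A : 'M[R]_(k, p)) (b : 'cV[R]_k) of (0 < k)%N
    & nn R k q : nn R p q.

Section networks.
Context {R : realType}.

Definition requ (x : R) : R := Num.max 0 x ^+ 2.

Definition l0norm {p q : nat} (A : 'M[R]_(p, q)) : nat :=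
  #|[pred ij : 'I_p * 'I_q | A ij.1 ij.2 != 0]|.

Fixpoint realization {p q : nat} (Phi : nn R p q) : 'cV[R]_p -> 'cV[R]_q :=
  match Phi with
  | nn_output _ _ A b => fun x => A *m x + b
  | nn_hidden _ _ _ A b _ Psi =>
      fun x => realization Psi (map_mx requ (A *m x + b))
  end.

Fixpoint depth {p q : nat} (Phi : nn R p q) : nat :=
  match Phi with
  | nn_output _ _ _ _ => 1%N
  | nn_hidden _ _ _ _ _ _ Psi => (depth Psi).+1
  end.

Fixpoint num_weights {p q : nat} (Phi : nn R p q) : nat :=
  match Phi with
  | nn_output _ _ A b => (l0norm A + l0norm b)%N
  | nn_hidden _ _ _ A b _ Psi => (l0norm A + l0norm b + num_weights Psi)%N
  end.

(* `|A| is the library's norm on matrices, the largest absolute value of an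
   entry. *)
Fixpoint weight_norm {p q : nat} (Phi : nn R p q) : R :=
  match Phi with
  | nn_output _ _ A b => Num.max `|A| `|b|
  | nn_hidden _ _ _ A b _ Psi =>
      Num.max (Num.max `|A| `|b|) (weight_norm Psi)
  end.

End networks.

Section approximation_space.
Local Open Scope ereal_scope.
Context {R : realType}.

Section gamma_sharp.
Variables l c : nat -> \bar R.

Definition depth_sup : \bar R := ereal_sup [set l n | n in [set n | (0 < n)%N]].

Definition gamma_sharp : \bar R := ereal_inf [set g%:E | g in [set g : R |
  (0 <= g)%R /\ exists2 C : R, (0 < C)%R & forall n L : nat,
    (0 < n)%N -> (0 < L)%N -> L%:R%:E <= depth_sup ->
    c n ^+ (2 ^ L - 1)%N * (n%:R `^ ((2 ^ L - 1)%N%:R / 2))%:E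
      <= (C * n%:R `^ g)%:E]].

End gamma_sharp.

Variables (d : nat) (l c : nat -> \bar R) (alpha : R).
Implicit Types u g : 'cV[R]_d -> R.

Definition Sigma (n : nat) : set ('cV[R]_d -> R) :=
  [set g | exists Phi : nn R d 1%N,
    [/\ g = (fun x => realization Phi x 0%R 0%R), (num_weights Phi <= n)%N,
        (depth Phi)%:R%:E <= l n & (weight_norm Phi)%:E <= c n]].

Definition Linf_norm u : \bar R := 'N[cube_measure d]_+oo [EFin \o u].

Definition approx_gauge u : \bar R :=
  maxe (Linf_norm u)
    (ereal_sup [set (n%:R `^ alpha)%:E *
                    ereal_inf [set Linf_norm (u \- g)%R | g in Sigma n]
               | n in [set n | (0 < n)%N]]).

Definition approx_norm u : \bar R :=
  ereal_inf [set t%:E | t in [set t : R |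
    (0 < t)%R /\ approx_gauge (fun x => u x / t)%R <= 1]].

(* Representatives of the elements of the approximation space. *)
Definition approx_space : set ('cV[R]_d -> R) :=
  [set u | u \in Lfun (cube_measure d) +oo /\ approx_norm u < +oo].

(* The continuous functions on [0,1]^d whose almost everywhere class lies in
   the unit ball of the approximation space. *)
Definition approx_ball : set (ccube R d) :=
  [set f : ccube R d | exists u, [/\ approx_space u, approx_norm u <= 1
    & (f : 'cV[R]_d -> R) = u %[ae (cube_measure d)]]].

End approximation_space.

Section optimal_orders.
Local Open Scope ereal_scope.
Context {R : realType} {d : nat} {Y : completeNormedModType R}.
Implicit Types (U : set (ccube R d)) (S : ccube R d -> Y) (m : nat).

(* Maps U -> Y are given by total functions, of which only the values on U are
   ever used. *)
Definition alg_det m U : set (ccube R d -> Y) :=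
  [set A | exists (x : 'I_m -> 'cV[R]_d) (Q : 'rV[R]_m -> Y),
    (forall i, cube d (x i)) /\
    forall u, U u -> A u = Q (\row_i u (x i))].

Definition err_det_m m U S : \bar R :=
  ereal_inf [set ereal_sup [set `|A u - S u|%:E | u in U] | A in alg_det m U].

Definition borel : Type := g_sigma_algebraType (@open Y).

Definition alg_mc m U {disp : measure_display} {Om : measurableType disp}
    (P : probability Om R) (A : Om -> ccube R d -> Y) (mm : Om -> nat) : Prop :=
  [/\ measurable_fun setT mm,
      forall w, (0 < mm w)%N,
      \int[P]_w (mm w)%:R%:E <= m%:R%:E,
      forall u, U u -> measurable_fun setT (fun w => A w u : borel)
    & forall w, alg_det (mm w) U (A w)].

Definition err_mc_m m U S : \bar R :=
  ereal_inf [set e | exists (disp : measure_display) (Om : measurableType disp)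
      (P : probability Om R) (A : Om -> ccube R d -> Y) (mm : Om -> nat),
    alg_mc m U P A mm /\
    e = ereal_sup [set \int[P]_w `|S u - A w u|%:E | u in U]].

Definition decay_order (e : nat -> \bar R) : \bar R :=
  ereal_sup [set beta%:E | beta in [set beta : R |
    (0 <= beta)%R /\ exists2 C : R, (0 < C)%R & forall m, (0 < m)%N ->
      e m <= (C * m%:R `^ (- beta))%:E]].

Definition err_det U S : \bar R := decay_order (fun m => err_det_m m U S).

Definition err_mc U S : \bar R := decay_order (fun m => err_mc_m m U S).

End optimal_orders.

(* Main.v *)
(* The realization of a ReQU network with [L] layers, at most [n] nonzero weights
   and weights bounded by [c] is Lipschitz on the cube with a constant of order
   [c ^ (2 ^ L - 1) * n ^ (2 ^ (L - 1) - 1)]. Finiteness of gamma# forces the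
   depth to be bounded, so for every admissible exponent [g] the functions in
   [Sigma n] are Lipschitz with constant [K * n ^ g]. Hence all functions of the
   unit ball share the modulus of continuity [n ^ -alpha + n ^ g * delta], for
   every [n]. The algorithm samples [u] on a grid of mesh [1 / k], with
   [k ^ d <= m], and returns any function of the unit ball with the same samples;
   its error is at most twice the modulus at [1 / k]. Balancing [n] against [k]
   gives the rate, and a deterministic algorithm is a Monte Carlo one. *)
Require Import Defs.
From mathcomp Require Import all_boot all_order all_algebra.
From mathcomp Require Import all_classical all_reals all_analysis.
From mathcomp Require Import ess_sup_inf ring lra zify.

Set Implicit Arguments.
Unset Strict Implicit.
Unset Printing Implicit Defensive.

Import Order.TTheory GRing.Theory Num.Theory.
Import numFieldNormedType.Exports.

Local Open Scope classical_set_scope.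
Local Open Scope ring_scope.

(** * Boxes and almost everywhere properties on the cube *)

Definition box {R : realType} {d : nat} (a b : 'I_d -> R) : set 'cV[R]_d :=
  [set x | forall i, a i <= x i 0 <= b i].

Lemma box_measurable (R : realType) (d : nat) (a b : 'I_d -> R) :
  measurable (box a b).
Proof.
rewrite (_ : box a b = \bigcap_(i in [set: 'I_d])
    (fun x : 'cV[R]_d => mx_entry (i, 0) x : R) @^-1` `[a i, b i]%classic).
  apply: fin_bigcap_measurable => [|i _]; first exact: finite_finset.
  rewrite -[X in measurable X]setTI.
  by apply: measurable_mx_entry => //; exact: measurable_itv.
by apply/seteqP; split=> [x xab i _|x xab i];
  [rewrite /= in_itv /=; exact: xab|have := xab i I; rewrite /= in_itv].
Qed.

(** Induction on [d]: the box is an interval of positive length times a lower-dimensional box, and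
    in dimension [0] the measure is the Dirac mass at the only point. *)
Lemma lebesgue_vec_box_gt0 (R : realType) (d : nat) (a b : 'I_d -> R) :
  (forall i, a i < b i) -> (0 < lebesgue_vec d (box a b))%E.
Proof.
elim: d a b => [|d IH] a b ab.
  by rewrite /= diracE mem_set ?lte01// => -[].
rewrite /= /lebesgue_step /pushforward.
rewrite (_ : _ @^-1` _ = `[a ord0, b ord0]%classic `*`
    box (fun i => a (lift ord0 i)) (fun i => b (lift ord0 i))); last first.
  have E0 (x : R) (v : 'cV[R]_d) : vec_cons (x, v) ord0 0 = x.
    rewrite (_ : ord0 = @lshift 1 d 0); last exact: val_inj.
    by rewrite [LHS]col_mxEu mxE.
  have ES (x : R) (v : 'cV[R]_d) i : vec_cons (x, v) (lift ord0 i) 0 = v i 0.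
    rewrite (_ : lift ord0 i = @rshift 1 d i); last exact: val_inj.
    by rewrite [LHS]col_mxEd.
  apply/seteqP; split=> -[x v] /=.
    move=> xv; split=> [|i] /=; last by rewrite -(ES x v) xv.
    by rewrite in_itv/= -(E0 x v) xv.
  move=> -[/= + vab] i; rewrite in_itv/= => xab.
  by case: (unliftP ord0 i) => [j|] ->; rewrite ?ES ?E0//; exact: vab.
rewrite product_measure1E//; last exact: box_measurable.
apply: mule_gt0; last by apply: IH.
suff : (0 < @lebesgue_measure R `[a ord0, b ord0]%classic)%E by [].
by rewrite lebesgue_measure_itv/= lte_fin ab -EFinB lte_fin subr_gt0.
Qed.

(** Otherwise the box would lie in the exceptional null set, although its measure is positive. *)
Lemma box_ae_exists (R : realType) (d : nat) (a b : 'I_d -> R)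
    (P : 'cV[R]_d -> Prop) :
  (forall i, 0 <= a i) -> (forall i, a i < b i) -> (forall i, b i <= 1) ->
  {ae cube_measure d, forall x, P x} -> exists2 x, box a b x & P x.
Proof.
move=> a0 ab b1 [N [mN N0 PN]]; apply: contrapT => noP.
have boxN : box a b `<=` N.
  by move=> x xab; apply: PN => Px; apply: noP; exists x.
have boxcube : box a b `<=` cube d.
  move=> x xab i; have /andP[ax xb] := xab i.
  by rewrite (le_trans _ ax) ?(le_trans xb).
have := lebesgue_vec_box_gt0 ab; rewrite lt0e => /andP[/eqP + _]; apply.
have N0' : lebesgue_vec d (N `&` cube d) = 0%E := N0.
apply: (subset_measure0 (box_measurable a b) _ _ N0').
  by apply: measurableI => //; exact: cube_measurable.
by move=> x xab; split; [exact: boxN|exact: boxcube].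
Qed.

Lemma cube_measure_gt0 (R : realType) (d : nat) :
  (0 < @cube_measure R d setT)%E.
Proof.
rewrite /= /mrestr setTI.
exact: (@lebesgue_vec_box_gt0 R d (fun=> 0) (fun=> 1)).
Qed.

(** Transfers almost everywhere estimates to every point of the cube: a small box around [x]
    contains a point where [P] holds, and continuity controls [f] there. *)
Lemma ae_near_cube (R : realType) (d : nat) (f : 'cV[R]_d -> R)
    (P : 'cV[R]_d -> Prop) (x : 'cV[R]_d) (e : R) :
  {within cube d, continuous f} -> {ae cube_measure d, forall y, P y} ->
  cube d x -> 0 < e ->
  exists y, [/\ cube d y, P y, forall i, `|x i 0 - y i 0| <= e &
     `|f x - f y| <= e].
Proof.
move=> cf aeP x01 e0.
have /(@cvgrPdist_lt _ _ _ (nbhs (x : subspace _)))/(_ _ e0) := cf x.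
move=> fx; have {fx} : within (cube d) (nbhs x) (fun y => `|f x - f y| < e).
  by rewrite nbhs_subspace_in.
move=> /nbhs_ballP[r /= r0 xr].
pose h := Num.min (Num.min e r / 2) 1.
have h0 : 0 < h by rewrite lt_min ltr01 andbT divr_gt0// lt_min e0.
have h1 : h <= 1 by rewrite ge_min lexx orbT.
have he : h <= Num.min e r / 2 by rewrite ge_min lexx.
have her : 0 < Num.min e r by rewrite lt_min e0.
have hlt : h < Num.min e r by lra.
move: hlt; rewrite lt_min => /andP[hlte hltr].
(* Near the upper faces the corner moves back to [1 - h], so that the box of side [h] contains [x]
   and stays in the cube. *)
pose a i := Num.min (x i 0) (1 - h).
have aE i : a i <= x i 0 /\ x i 0 <= a i + h.
  have /andP[x0 x1] := x01 i; split; first by rewrite ge_min lexx.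
  by rewrite /a minElt; case: ifP; lra.
have a0 i : 0 <= a i by have /andP[x0 x1] := x01 i; rewrite le_min x0/=; lra.
have ah1 i : a i + h <= 1.
  by rewrite -lerBrDr ge_min lexx orbT.
have aah i : a i < a i + h by rewrite ltrDl.
have [y yab Py] := box_ae_exists a0 aah ah1 aeP.
have xy i : `|x i 0 - y i 0| <= h.
  have /andP[y1 y2] := yab i; have [x1 x2] := aE i.
  by rewrite ler_norml; apply/andP; split; lra.
have y01 : cube d y.
  move=> i; have /andP[y1 y2] := yab i.
  by rewrite (le_trans (a0 i))// (le_trans y2).
exists y; split=> // [i|]; first exact: le_trans (xy i) (ltW hlte).
apply: ltW; apply: xr => //; split=> // i j; rewrite (ord1 j) /ball/=.
exact: le_lt_trans (xy i) hltr.
Qed.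

(** * Lipschitz constants of ReQU networks *)

Lemma mx_entry_le_norm (R : realType) (m n : nat) (A : 'M[R]_(m, n)) i j :
  `|A i j| <= `|A|.
Proof.
rewrite [leRHS]mx_normrE.
exact: (le_bigmax _ (fun ij : 'I_m * 'I_n => `|A ij.1 ij.2|) (i, j)).
Qed.

(** Nonzero entries are counted instead of columns, because the number of weights does not bound the
    width of a network. *)
Lemma row_sum_le_l0norm (R : realType) (m n : nat) (A : 'M[R]_(m, n)) (c : R) i :
  `|A| <= c -> \sum_j `|A i j| <= (l0norm A)%:R * c.
Proof.
move=> Ac; have c0 : 0 <= c by exact: le_trans (normr_ge0 _) Ac.
have -> : (l0norm A)%:R * c = \sum_i \sum_j (if A i j != 0 then c else 0).
  by rewrite pair_bigA/= -big_mkcond/= sumr_const mulr_natl.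
rewrite [leRHS](bigD1 i)//= ler_wpDr//.
  by apply: sumr_ge0 => k _; apply: sumr_ge0 => j _; case: ifP.
apply: ler_sum => j _; case: eqVneq => [->|_]; first by rewrite normr0.
exact: le_trans (mx_entry_le_norm A i j) Ac.
Qed.

Section affine_layer.
Context {R : realType} {p q : nat} (A : 'M[R]_(q, p)) (b : 'cV[R]_q).
Context (s c : R) (i : 'I_q) (As : \sum_j `|A i j| <= s) (bc : `|b| <= c).

Lemma mulmx_entry_le (x : 'cV[R]_p) (V : R) : 0 <= V ->
  (forall j, `|x j 0| <= V) -> `|(A *m x) i 0| <= s * V.
Proof.
move=> V0 xV; rewrite mxE; apply: le_trans (ler_norm_sum _ _ _) _.
apply: le_trans (_ : (\sum_j `|A i j|) * V <= _); last exact: ler_wpM2r.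
by rewrite mulr_suml; apply: ler_sum => j _; rewrite normrM ler_wpM2l.
Qed.

Lemma affine_entry_le (x : 'cV[R]_p) (V : R) : 0 <= V ->
  (forall j, `|x j 0| <= V) -> `|(A *m x + b) i 0| <= s * V + c.
Proof.
move=> V0 xV; rewrite mxE; apply: le_trans (ler_normD _ _) _.
apply: lerD; first exact: mulmx_entry_le.
exact: le_trans (mx_entry_le_norm b i 0) bc.
Qed.

Lemma affine_entry_lip (x y : 'cV[R]_p) (e : R) : 0 <= e ->
  (forall j, `|x j 0 - y j 0| <= e) ->
  `|(A *m x + b) i 0 - (A *m y + b) i 0| <= s * e.
Proof.
move=> e0 xy; rewrite [X in X - _]mxE [X in _ - X]mxE opprD addrACA subrr addr0.
have -> : (A *m x) i 0 - (A *m y) i 0 = (A *m (x - y)) i 0.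
  by rewrite mulmxBr [RHS]mxE; congr (_ + _); rewrite [RHS]mxE.
by apply: mulmx_entry_le => // j; rewrite mxE [X in _ + X]mxE.
Qed.

End affine_layer.

Lemma requ_le (R : realType) (u M : R) : `|u| <= M -> `|requ u| <= M ^+ 2.
Proof.
move=> uM; have M0 : 0 <= M by exact: le_trans (normr_ge0 _) uM.
rewrite /requ ger0_norm ?sqr_ge0// ler_sqr ?nnegrE// ?le_max ?lexx//.
by rewrite ge_max M0/=; exact: le_trans (ler_norm _) uM.
Qed.

(** The difference of squares factors: the positive parts sum to at most [2 * M], and the positive
    part is [1]-Lipschitz. *)
Lemma requ_lip (R : realType) (u v M e : R) : `|u| <= M -> `|v| <= M ->
  `|u - v| <= e -> `|requ u - requ v| <= 2 * M * e.
Proof.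
move=> uM vM uv; have M0 : 0 <= M by exact: le_trans (normr_ge0 _) uM.
rewrite /requ subr_sqr normrM mulrC; apply: ler_pM => //.
  move: uM vM; rewrite !ler_norml => /andP[? ?] /andP[? ?].
  by rewrite !maxElt; do 2![case: ifP]; lra.
move: uv; rewrite !ler_norml => /andP[? ?].
by rewrite !maxElt; apply/andP; split; do 2![case: ltP => ?]; lra.
Qed.

Section hidden_layer.
Context {R : realType} {p q : nat} (A : 'M[R]_(q, p)) (b : 'cV[R]_q).
Context (s c V M : R) (bc : `|b| <= c) (V0 : 0 <= V).
Context (As : forall i, \sum_j `|A i j| <= s) (sVcM : s * V + c <= M).

Lemma hidden_layer_le (x : 'cV[R]_p) : (forall j, `|x j 0| <= V) ->
  forall i, `|map_mx requ (A *m x + b) i 0| <= M ^+ 2.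
Proof.
move=> xV i; rewrite mxE; apply: requ_le; apply: le_trans sVcM.
exact: affine_entry_le.
Qed.

Lemma hidden_layer_lip (x y : 'cV[R]_p) (e : R) : 0 <= e ->
  (forall j, `|x j 0| <= V) -> (forall j, `|y j 0| <= V) ->
  (forall j, `|x j 0 - y j 0| <= e) ->
  forall i, `|map_mx requ (A *m x + b) i 0 - map_mx requ (A *m y + b) i 0|
    <= 2 * M * (s * e).
Proof.
move=> e0 xV yV xy i; rewrite [X in X - _]mxE [X in _ - X]mxE; apply: requ_lip.
- by apply: le_trans sVcM; exact: affine_entry_le.
- by apply: le_trans sVcM; exact: affine_entry_le.
- exact: affine_entry_lip.
Qed.

End hidden_layer.

Lemma pow2S_pred m : (2 ^ m.+1 - 1 = 2 * (2 ^ m - 1) + 1)%N.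
Proof. by rewrite expnS; have := expn_gt0 2 m; case: (2 ^ m)%N => // u _; lia. Qed.

Lemma pow2S2_pred m :
  (2 ^ m.+2 - 1 = 2 ^ m.+1 - 1 + 2 * (2 ^ m - 1) + 2)%N.
Proof. by rewrite (pow2S_pred m.+1) (pow2S_pred m); move: (2 ^ m - 1)%N => k; lia. Qed.

Lemma depth_gt0 (R : realType) p q (Phi : nn R p q) : (0 < depth Phi)%N.
Proof. by case: Phi. Qed.

(** Induction on the network for all [V] and [e]: with [B = 2 * n * c], a hidden layer turns the
    bound [V] into [(B * V) ^ 2] and the distance [e] into [B ^ 2 * V * e]. The exponents solve this
    recursion. *)
Lemma realization_lip (R : realType) p q (Phi : nn R p q) (n : nat) (c V e : R)
    (x y : 'cV[R]_p) (i : 'I_q) :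
  (0 < n)%N -> 1 <= c -> 1 <= V -> 0 <= e ->
  (num_weights Phi <= n)%N -> weight_norm Phi <= c ->
  (forall j, `|x j 0| <= V) -> (forall j, `|y j 0| <= V) ->
  (forall j, `|x j 0 - y j 0| <= e) ->
  `|realization Phi x i 0 - realization Phi y i 0| <=
    (2 * n%:R * c) ^+ (2 ^ depth Phi - 1) * V ^+ (2 ^ (depth Phi).-1 - 1) * e.
Proof.
move=> n0 c1.
have n1 : 1 <= n%:R :> R by rewrite ler1n.
have nc1 : 1 <= n%:R * c by rewrite mulr_ege1.
elim: Phi V e x y i => {p q} [p q A b|p k q A b _ Psi IH] V e x y i V1 e0 /=.
  move=> An; rewrite ge_max => /andP[Ac _] _ _ xy.
  have As : \sum_j `|A i j| <= n%:R * c.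
    apply: le_trans (row_sum_le_l0norm i Ac) _; rewrite ler_wpM2r ?ler_nat; try lra.
    exact: leq_trans (leq_addr _ _) An.
  rewrite expn1 expn0 subn1 subnn expr0 mulr1 expr1.
  apply: le_trans (affine_entry_lip b As e0 xy) _.
  by rewrite ler_wpM2r//; lra.
move=> An; rewrite !ge_max => /andP[/andP[Ac bc] Pc] xV yV xy.
have As j : \sum_k `|A j k| <= n%:R * c.
  apply: le_trans (row_sum_le_l0norm j Ac) _; rewrite ler_wpM2r ?ler_nat; try lra.
  by apply: leq_trans An; rewrite -addnA leq_addr.
(* As [n * V >= 1], doubling the first term absorbs the bias. *)
have sM : n%:R * c * V + c <= 2 * n%:R * c * V.
  suff : c <= n%:R * c * V by lra.
  by rewrite -[leLHS]mul1r -mulrA ler_pM ?ler_peMr//; lra.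
have V0 : 0 <= V by lra.
set B := 2 * n%:R * c in sM *.
have B1 : 1 <= B by rewrite /B; lra.
have BV1 : 1 <= (B * V) ^+ 2 by rewrite exprn_ege1// mulr_ege1.
have x'V := hidden_layer_le bc V0 As sM xV.
have y'V := hidden_layer_le bc V0 As sM yV.
have e'0 : 0 <= 2 * (B * V) * (n%:R * c * e).
  by rewrite !mulr_ge0//; lra.
have x'y' := hidden_layer_lip bc V0 As sM e0 xV yV xy.
have Pn : (num_weights Psi <= n)%N by rewrite (leq_trans _ An)// leq_addl.
apply: le_trans (IH _ _ _ _ i BV1 e'0 Pn Pc x'V y'V x'y') _.
rewrite le_eqVlt; apply/orP; left; apply/eqP.
have := depth_gt0 Psi; case: (depth Psi) => // m _ /=.
have -> : 2 * (B * V) * (n%:R * c * e) = B ^+ 2 * V * e by rewrite /B; ring.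
rewrite -/B; clearbody B; rewrite pow2S2_pred pow2S_pred; move: (2 ^ m - 1)%N => u.
by rewrite !(mulnC 2%N) !exprD expr1 !exprM !exprMn; ring.
Qed.

(* On the cube the first layer has only [d] inputs per neuron, so its row sums
   are at most [d * c] instead of [n * c]; this lowers the power of [n] from
   [2 ^ L - 1] to [2 ^ (L - 1) - 1], below the [(2 ^ L - 1) / 2] of gamma#. *)
Lemma realization_cube_lip (R : realType) d q (Phi : nn R d q) (n : nat)
    (c e : R) (x y : 'cV[R]_d) (i : 'I_q) :
  (0 < n)%N -> 1 <= c -> 0 <= e ->
  (num_weights Phi <= n)%N -> weight_norm Phi <= c ->
  cube d x -> cube d y -> (forall j, `|x j 0 - y j 0| <= e) ->
  `|realization Phi x i 0 - realization Phi y i 0| <=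
    (2 * d.+1%:R) ^+ (2 ^ (depth Phi).-1) *
    (c ^+ (2 ^ depth Phi - 1) * n%:R ^+ (2 ^ (depth Phi).-1 - 1)) * e.
Proof.
move=> n0 c1 e0.
have n1 : 1 <= n%:R :> R by rewrite ler1n.
have cube_le (z : 'cV[R]_d) : cube d z -> forall j, `|z j 0| <= 1.
  by move=> z01 j; have /andP[? ?] := z01 j; rewrite ger0_norm.
have Ad (k : nat) (A : 'M[R]_(k, d)) j : `|A| <= c -> \sum_l `|A j l| <= d%:R * c.
  move=> Ac; rewrite mulr_natl -[X in _ *+ X]card_ord -sumr_const.
  by apply: ler_sum => l _; exact: le_trans (mx_entry_le_norm A j l) Ac.
have d0 : 0 <= d%:R :> R by [].
have dS : d.+1%:R = d%:R + 1 :> R by rewrite -natr1.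
have dc0 : 0 <= d%:R * c by rewrite mulr_ge0//; lra.
case: Phi cube_le Ad d0 dS dc0 x y i => {d q} [d q A b|d k q A b _ Psi] cube_le Ad d0 dS dc0 x y i /=.
  move=> _; rewrite ge_max => /andP[Ac _] _ _ xy.
  rewrite expn1 expn0 subn1 subnn expr0 mulr1 !expr1.
  apply: le_trans (affine_entry_lip b (Ad _ A i Ac) e0 xy) _.
  by rewrite ler_wpM2r// ler_wpM2r//; lra.
move=> An; rewrite !ge_max => /andP[/andP[Ac bc] Pc] x01 y01 xy.
set D : R := d.+1%:R in dS *.
(* Inputs from the cube are bounded by [1], so the row sum [d * c] and the bias [c] add up to
   [(d + 1) * c]. *)
have sM : d%:R * c * 1 + c <= D * c by rewrite dS; lra.
have As j := Ad _ A j Ac.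
have x'V := hidden_layer_le bc ler01 As sM (cube_le x x01).
have y'V := hidden_layer_le bc ler01 As sM (cube_le y y01).
have x'y' := hidden_layer_lip bc ler01 As sM e0 (cube_le x x01) (cube_le y y01) xy.
have D1 : 1 <= D by rewrite dS; lra.
have DV1 : 1 <= (D * c) ^+ 2 by rewrite exprn_ege1// mulr_ege1.
have e'0 : 0 <= 2 * (D * c) * (d%:R * c * e).
  by rewrite !mulr_ge0//; lra.
have Pn : (num_weights Psi <= n)%N by rewrite (leq_trans _ An)// leq_addl.
apply: le_trans (realization_lip i n0 c1 DV1 e'0 Pn Pc x'V y'V x'y') _.
have := depth_gt0 Psi; case: (depth Psi) => // m _ /=.
(* Enlarging the remaining factor [d] to [D] turns the bound into a monomial that equals the claimed
   one. *)
apply: le_trans (_ : (2 * n%:R * c) ^+ (2 ^ m.+1 - 1) *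
  ((D * c) ^+ 2) ^+ (2 ^ m - 1) * (2 * (D * c) * (D * c * e)) <= _).
  apply: ler_wpM2l; first by rewrite mulr_ge0// exprn_ge0// ?mulr_ge0//; lra.
  apply: ler_wpM2l; first by rewrite !mulr_ge0//; lra.
  by apply: ler_wpM2r => //; apply: ler_wpM2r; lra.
rewrite le_eqVlt; apply/orP; left; apply/eqP.
rewrite pow2S2_pred (_ : 2 ^ m.+1 = 2 * (2 ^ m - 1) + 2)%N; last first.
  by rewrite -[LHS](@subnK 1) ?expn_gt0// pow2S_pred -addnA.
clearbody D; move: (2 ^ m - 1)%N (n%:R : R) => u N.
rewrite -addnBA// !(mulnC 2%N) !exprD !exprM expr1 !exprMn.
by ring.
Qed.

(** * Modulus of continuity of the unit ball *)

(** The condition under the infimum that defines [gamma_sharp]. *)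
Definition admissible_order {R : realType} (l c : nat -> \bar R) (g : R) : Prop :=
  0 <= g /\ exists2 C : R, 0 < C & forall n L : nat,
    (0 < n)%N -> (0 < L)%N -> (L%:R%:E <= depth_sup l)%E ->
    (c n ^+ (2 ^ L - 1)%N * (n%:R `^ ((2 ^ L - 1)%N%:R / 2))%:E
      <= (C * n%:R `^ g)%:E)%E.

Lemma Nbar_ge1 (R : realType) (x : \bar R) : Nbar x -> (1%:E <= x)%E.
Proof. by case=> [->|[k k0 ->]]; rewrite ?leey// lee_fin ler1n. Qed.

Lemma le_depth_sup (R : realType) (l : nat -> \bar R) n :
  (0 < n)%N -> (l n <= depth_sup l)%E.
Proof. by move=> n0; apply: ereal_sup_ubound; exists n. Qed.

Section admissible.
Context {R : realType} (l c : nat -> \bar R).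
Context (lN : forall n : nat, (0 < n)%N -> Nbar (l n)).
Context (cN : forall n : nat, (0 < n)%N -> Nbar (c n)).

(** An infinite [c n] would violate the condition at [L = 1], a depth always allowed because
    [l n >= 1]. *)
Lemma admissible_width (g : R) : admissible_order l c g ->
  forall n, (0 < n)%N -> exists2 k : nat, (0 < k)%N & c n = k%:R%:E.
Proof.
move=> [g0 [C C0 Cn]] n n0; case: (cN n0) => // cy.
have := Cn n 1 n0 isT (le_trans (Nbar_ge1 (lN n0)) (le_depth_sup l n0)).
rewrite cy expn1 subn1 /= gt0_mulye ?leye_eq//.
by rewrite lte_fin powR_gt0// ltr0n.
Qed.

(** At [n = 2] the left side of the condition grows at least doubly exponentially in [L], while the
    right side is fixed. The choice [n = 1] would not bound [L] when [c 1 = 1]. *)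
Lemma admissible_depth (g : R) : admissible_order l c g ->
  exists M : nat, forall k n, (0 < n)%N -> (k%:R%:E <= l n)%E -> (k <= M)%N.
Proof.
move=> adm; have [c2 c20 c2E] := admissible_width adm (isT : (0 < 2)%N).
case: adm => g0 [C C0 Cn].
(* Squaring the condition bounds [2 ^ (2 ^ k - 1)], which is at least [k], by the truncated
   number. *)
exists (Num.trunc ((C * 2 `^ g) ^+ 2)) => k n n0 kl.
have [->//|k0] := posnP k.
have B0 : 0 <= C * 2 `^ g by rewrite mulr_ge0 ?powR_ge0// ltW.
rewrite truncn_ge_nat ?sqr_ge0//.
have /Cn := isT : (0 < 2)%N => /(_ k k0 (le_trans kl (le_depth_sup l n0))).
rewrite c2E -EFin_expe -EFinM lee_fin => c2k.
have k2 : 2 `^ ((2 ^ k - 1)%N%:R / 2) <= C * 2 `^ g.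
  apply: le_trans c2k; rewrite ler_peMl ?powR_ge0//.
  by rewrite exprn_ege1// ler1n.
apply: le_trans (_ : (2 `^ ((2 ^ k - 1)%N%:R / 2)) ^+ 2 <= _); last first.
  by rewrite ler_sqr ?nnegrE ?powR_ge0.
rewrite -powR_mulrn ?powR_ge0// -powRrM divfK// powR_mulrn// -natrX ler_nat.
apply: leq_trans (ltnW (ltn_expl _ (isT : (1 < 2)%N))); last first.
by rewrite leq_subRL ?expn_gt0// add1n ltn_expl.
Qed.

Lemma Sigma_lip (d : nat) (g : R) : admissible_order l c g ->
  exists2 K : R, 0 < K & forall n h x y e, (0 < n)%N -> Sigma l c n h -> 0 <= e ->
    cube d x -> cube d y -> (forall j, `|x j 0 - y j 0| <= e) ->
    `|h x - h y| <= K * n%:R `^ g * e.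
Proof.
move=> adm; have [M depthM] := admissible_depth adm.
have width := admissible_width adm.
case: adm => g0 [C C0 Cn].
have D1 : 1 <= 2 * d.+1%:R :> R by rewrite -natrM ler1n.
exists ((2 * d.+1%:R) ^+ (2 ^ M) * C).
  by rewrite mulr_gt0// exprn_gt0// (lt_le_trans ltr01).
move=> n h x y e n0 [Phi [-> wPhi dPhi cPhi]] e0 x01 y01 xy.
have [k k0 ck] := width n n0; rewrite ck lee_fin in cPhi.
have k1 : 1 <= k%:R :> R by rewrite ler1n.
have n1 : 1 <= n%:R :> R by rewrite ler1n.
apply: le_trans (realization_cube_lip ord0 n0 k1 e0 wPhi cPhi x01 y01 xy) _.
have := Cn n (depth Phi) n0 (depth_gt0 Phi) (le_trans dPhi (le_depth_sup l n0)).
rewrite ck -EFin_expe -EFinM lee_fin => cC.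
rewrite ler_wpM2r// -mulrA ler_pM//.
  rewrite ler_weXn2l// leq_exp2l//; apply: leq_trans (leq_pred _) _.
  exact: depthM dPhi.
(* The power of [n] fits because [2 ^ (L - 1) - 1 <= (2 ^ L - 1) / 2]. *)
apply: le_trans cC; rewrite ler_wpM2l ?exprn_ge0//.
rewrite -powR_mulrn//; apply: ler_powR => //.
have := depth_gt0 Phi; case: (depth Phi) => // m _ /=.
rewrite pow2S_pred; move: (2 ^ m - 1)%N => u.
by rewrite natrD natrM; lra.
Qed.

End admissible.

(** Compare [f] with [t * h], where [h] is a network function and [t < 2], at points [x'], [y'] near
    [x], [y] where the almost everywhere bound holds. The [10] collects two approximation errors
    [4 * a] and two moves of size at most [a]; the [6] is the factor [2] for [t] times [3 * e],
    which bounds the distance of [x'] and [y']. *)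
Lemma approx_ball_modulus (R : realType) (l c : nat -> \bar R) (d : nat)
    (alpha L e : R) (n : nat) (f : ccube R d) (x y : 'cV[R]_d) :
  (0 < n)%N -> 0 <= L -> 0 < e ->
  (forall h z w r, Sigma l c n h -> (0 : R) <= r -> cube d z -> cube d w ->
     (forall j, `|z j 0 - w j 0| <= r) -> `|h z - h w| <= L * r) ->
  approx_ball l c alpha f -> cube d x -> cube d y ->
  (forall j, `|x j 0 - y j 0| <= e) ->
  `|f x - f y| <= 10 * n%:R `^ (- alpha) + 6 * L * e.
Proof.
move=> n0 L0 e0 lipL [u [_ u1 fu]] x01 y01 xy.
set a : R := n%:R `^ (- alpha).
have a0 : 0 < a by rewrite powR_gt0// ltr0n.
(* The infima need not be attained, so a scale below [2] and an error below [2 * a] stand in for [1]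
   and [a]. *)
have /ereal_inf_lt[_ [t [t0 ut] <-]] : (approx_norm l c alpha u < 2%:E)%E.
  by apply: le_lt_trans u1 _; rewrite lte_fin ltr1n.
rewrite lte_fin => t2.
have /ereal_inf_lt[_ [h hS <-] uh] : (ereal_inf
    [set Linf_norm (fun x => (u x / t - h x)%R) | h in Sigma l c n] < (2 * a)%:E)%E.
  apply: (@le_lt_trans _ _ a%:E); last by rewrite lte_fin; lra.
  move: ut; rewrite ge_max => /andP[_ ut].
  have na0 : 0 < n%:R `^ alpha by rewrite powR_gt0// ltr0n.
  rewrite -[a%:E]mule1 /a powRN lee_pdivlMl//.
  by apply: le_trans ut; apply: ereal_sup_ubound; exists n.
have uha : {ae cube_measure d, forall z, `|u z / t - h z| <= 2 * a}.
  (* The norm is an essential supremum only on a space of positive measure. *)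
  move: uh; rewrite /Linf_norm unlock/= cube_measure_gt0 => /ltW/ess_supP.
  by apply: filterS => z; rewrite /= lee_fin.
pose P z := `|f z - t * h z| <= 4 * a.
have aeP : {ae cube_measure d, forall z, P z}.
  apply: filterS2 fu uha => z fuz uhz; rewrite /P fuz//.
  have -> : u z - t * h z = t * (u z / t - h z) by field; lra.
  rewrite normrM gtr0_norm//.
  have := normr_ge0 (u z / t - h z); nra.
pose r := Num.min e a.
have r0 : 0 < r by rewrite lt_min e0.
have re : r <= e by rewrite ge_min lexx.
have ra : r <= a by rewrite ge_min lexx orbT.
have [x' [x'01 Px' xx' fxx']] := @ae_near_cube R d f P x r (@ccube_cts R d f) aeP x01 r0.
have [y' [y'01 Py' yy' fyy']] := @ae_near_cube R d f P y r (@ccube_cts R d f) aeP y01 r0.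
have hxy : `|h x' - h y'| <= L * (3 * e).
  apply: lipL => // [|j]; first by lra.
  have := xx' j; have := yy' j; have := xy j; rewrite !ler_norml.
  by move=> /andP[? ?] /andP[? ?] /andP[? ?]; apply/andP; split; lra.
have thxy : `|t * h x' - t * h y'| <= 6 * L * e.
  by rewrite -mulrBr normrM gtr0_norm//; have := normr_ge0 (h x' - h y'); nra.
move: Px' Py' fxx' fyy' thxy; rewrite /P !ler_norml.
by do 5![move=> /andP[? ?]]; apply/andP; split; lra.
Qed.

(** * Sampling on a grid *)

Lemma cube_grid (R : realType) (d k m : nat) : (0 < k)%N -> (k ^ d <= m)%N ->
  exists x : 'I_m -> 'cV[R]_d, (forall i, cube d (x i)) /\
    forall y, cube d y -> exists i, forall j, `|y j 0 - x i j 0| <= k%:R^-1.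
Proof.
move=> k0 km; have kR : 0 < k%:R :> R by rewrite ltr0n.
pose pt (p : {ffun 'I_d -> 'I_k}) : 'cV[R]_d := \col_j ((p j)%:R / k%:R).
pose s := [seq pt p | p <- enum {: {ffun 'I_d -> 'I_k}}].
have pt01 p : cube d (pt p).
  move=> j; rewrite mxE divr_ge0//= ler_pdivrMr// mul1r ler_nat.
  exact/ltnW/ltn_ord.
have size_s : size s = (k ^ d)%N by rewrite size_map -cardE card_ffun !card_ord.
exists (fun i : 'I_m => nth 0 s i); split=> [i|y y01].
  (* Indices beyond the [k ^ d] grid points sample the origin. *)
  have [is_|si] := ltnP i (size s); last by rewrite nth_default//; exact: cube0.
  by have /mapP[p _ ->] := mem_nth 0 is_.
have /choice[p yp] : forall j, exists p : 'I_k, `|y j 0 - p%:R / k%:R| <= k%:R^-1.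
  move=> j; have /andP[y0 y1] := y01 j.
  have ky0 : 0 <= k%:R * y j 0 by rewrite mulr_ge0.
  have /andP[tl tr] := truncn_itv ky0.
  have distE (z : R) : `|k%:R * y j 0 - z| <= 1 -> `|y j 0 - z / k%:R| <= k%:R^-1.
    move=> kyz; rewrite -[y j 0](mulKf (lt0r_neq0 kR)) [X in X - _]mulrC -mulrBl.
    by rewrite normrM normfV (gtr0_norm kR) ler_pdivrMr// mulVf// gt_eqF.
  (* Truncation leaves the index range only for [y j 0 = 1]; the index [k - 1] then serves, at
     distance exactly [1 / k]. *)
  have [tk|kt] := ltnP (Num.trunc (k%:R * y j 0)) k.
    exists (Ordinal tk); apply: distE => /=.
    by rewrite ger0_norm ?subr_ge0// lerBlDr addrC natr1 ltW.
  have k1k : (k.-1 < k)%N by rewrite prednK.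
  exists (Ordinal k1k); apply: distE => /=.
  have ky : k%:R * y j 0 = k%:R.
    apply/eqP; rewrite eq_le ler_piMr//=; apply: le_trans tl.
    by rewrite ler_nat.
  by rewrite ky -natrB ?leq_pred// -[X in (X - _)%N](prednK k0) subSnn normr1.
have ps : pt [ffun j => p j] \in s by apply: map_f; rewrite mem_enum.
have im : (index (pt [ffun j => p j]) s < m)%N.
  by apply: leq_trans km; rewrite -size_s index_mem.
by exists (Ordinal im) => j; rewrite /= nth_index// mxE ffunE.
Qed.

(* [Q] picks any member of [U] with the given samples, which avoids constructing
   a continuous interpolant. *)
Lemma alg_det_of_modulus (R : realType) (d k m : nat) (U : set (ccube R d)) (w : R) :
  (0 < k)%N -> (k ^ d <= m)%N ->
  (forall f x y, U f -> cube d x -> cube d y ->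
    (forall j, `|x j 0 - y j 0| <= k%:R^-1) -> `|f x - f y| <= w) ->
  exists2 A : ccube R d -> ccube R d, alg_det m U A &
    forall u, U u -> `|A u - u| <= 2 * w.
Proof.
move=> k0 km Uw; have [x [x01 xgrid]] := cube_grid R k0 km.
pose sample (u : ccube R d) : 'rV[R]_m := \row_i u (x i).
have /choice[Q QP] : forall v, exists q : ccube R d,
    forall u, U u -> sample u = v -> U q /\ sample q = v.
  move=> v; have [[u [Uu uv]]|nu] := pselect (exists u, U u /\ sample u = v).
    by exists u.
  (* A vector that is no sample of a member of [U] gets an arbitrary value. *)
  by exists 0 => u Uu uv; exfalso; apply: nu; exists u.
exists (Q \o sample); first by exists x, Q; split.
move=> u Uu; have [Uq qu] := QP _ u Uu erefl.
apply: ccube_norm_le => y y01; have [i yi] := xgrid y y01.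
(* Both functions agree at the grid point [x i], and each changes by at most [w] from there to
   [y]. *)
have /rowP/(_ i) := qu; rewrite !mxE => qux.
have := Uw _ _ _ Uu y01 (x01 i) yi; have := Uw _ _ _ Uq y01 (x01 i) yi.
rewrite qux /= => quy uy; rewrite -[leLHS]/(`|Q (sample u) y - u y|).
move: quy uy; rewrite !ler_norml.
by do 2![move=> /andP[? ?]]; apply/andP; split; lra.
Qed.

(** * Balancing the network size against the mesh *)

Lemma root_nat (d m : nat) : (0 < d)%N -> (0 < m)%N ->
  exists2 k : nat, (0 < k)%N & (k ^ d <= m < k.+1 ^ d)%N.
Proof.
move=> d0 m0.
have km k : (k ^ d <= m)%N -> (k <= m)%N.
  by apply: leq_trans; case: k => // k; rewrite -[X in (X <= _)%N]expn1 leq_pexp2l.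
have [|k kd kmax] := @ex_maxnP (fun k => k ^ d <= m)%N m _ km.
  by exists 1%N; rewrite exp1n.
have k0 : (0 < k)%N by apply: kmax; rewrite exp1n.
exists k => //; rewrite kd ltnNge; apply/negP => /kmax.
by rewrite ltnn.
Qed.

(* [n] is the size at which the approximation error [n^-alpha] and the
   oscillation [n^g / k] of the networks on a grid cell balance. *)
Lemma balancing_size (R : realType) (alpha g : R) (k : nat) :
  0 < alpha -> 0 <= g -> (0 < k)%N ->
  exists n : nat, [/\ (0 < n)%N,
    n%:R `^ (- alpha) <= k%:R `^ (- (alpha / (alpha + g))) &
    n%:R `^ g * k%:R^-1 <= 2 `^ g * k%:R `^ (- (alpha / (alpha + g)))].
Proof.
move=> a0 g0 k0; have k1 : 1 <= k%:R :> R by rewrite ler1n.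
have ag0 : alpha + g != 0 by rewrite gt_eqF// ltr_wpDr.
have p1 : 1 <= k%:R `^ (alpha + g)^-1 :> R.
  rewrite -[leLHS](powRr0 k%:R); apply: ler_powR => //.
  by rewrite invr_ge0; lra.
set p := _ `^ _ in p1.
have pX (r : R) : p `^ r = k%:R `^ (r / (alpha + g)).
  by rewrite /p -powRrM mulrC.
have p0 : 0 <= p by lra.
have /andP[np pn] := truncn_itv p0.
(* The real number [p] solves the balance equation exactly. Rounding up keeps the first bound; since
   [p >= 1], it at most doubles [p], which costs the factor with exponent [g] in the second. *)
exists (Num.trunc p).+1.
have n2p : (Num.trunc p).+1%:R <= 2 * p by rewrite -natr1; lra.
have n0 : 0 < (Num.trunc p).+1%:R :> R by rewrite ltr0n.
split=> //.
  rewrite -mulNr -pX !powRN lef_pV2 ?posrE ?powR_gt0//; last by lra.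
  by apply: ge0_ler_powR; rewrite ?nnegrE; lra.
apply: le_trans (_ : (2 * p) `^ g * k%:R^-1 <= _).
  apply: ler_wpM2r; first by rewrite invr_ge0; lra.
  by apply: ge0_ler_powR; rewrite ?nnegrE; lra.
rewrite powRM//.
rewrite -mulrA ler_wpM2l ?powR_ge0// pX -(@powR_inv1 _ k%:R)//.
rewrite -powRD; last by apply/implyP => _; rewrite gt_eqF//; lra.
rewrite le_eqVlt; apply/orP; left; apply/eqP; congr (_ `^ _).
by field.
Qed.

Lemma alg_det_rate (R : realType) (l c : nat -> \bar R)
    (lN : forall n : nat, (0 < n)%N -> Nbar (l n))
    (cN : forall n : nat, (0 < n)%N -> Nbar (c n))
    (d : nat) (alpha g : R) : (0 < d)%N -> 0 < alpha ->
  admissible_order l c g ->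
  exists2 C : R, 0 < C & forall m, (0 < m)%N ->
    exists2 A : ccube R d -> ccube R d, alg_det m (approx_ball l c alpha) A &
      forall u, approx_ball l c alpha u ->
        `|A u - u| <= C * m%:R `^ (- (alpha / (d%:R * (alpha + g)))).
Proof.
move=> d0 a0 adm; have [K K0 Klip] := Sigma_lip lN cN d adm.
have g0 := adm.1; have ag0 : 0 < alpha + g by rewrite ltr_wpDr.
pose s := alpha / (alpha + g).
have s0 : 0 <= s by rewrite divr_ge0// ltW.
have C'0 : 0 < 10 + 6 * K * 2 `^ g by rewrite ltr_pwDl// !mulr_ge0 ?powR_ge0// ltW.
(* The [2] comes from the sampling algorithm, the bracket from the modulus at the balanced [n], and
   the last factor from passing from [k] to [m] through [m < (k + 1) ^ d <= (2 * k) ^ d]. *)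
exists (2 * (10 + 6 * K * 2 `^ g) * 2 `^ s).
  by rewrite !mulr_gt0// powR_gt0.
move=> m m0; have [k k0 /andP[km mk]] := root_nat d0 m0.
have kR : 0 < k%:R :> R by rewrite ltr0n.
have [n [n0 na ng]] := balancing_size a0 g0 k0.
have [|A mA uA] := @alg_det_of_modulus R d k m (approx_ball l c alpha)
    ((10 + 6 * K * 2 `^ g) * k%:R `^ (- s)) k0 km.
  move=> f x y Uf x01 y01 xy.
  apply: le_trans (@approx_ball_modulus _ l c d alpha (K * n%:R `^ g) k%:R^-1
    n f x y n0 _ _ _ Uf x01 y01 xy) _.
  - by rewrite mulr_ge0 ?powR_ge0// ltW.
  - by rewrite invr_gt0.
  - by move=> h z w r hS r0 z01 w01; exact: Klip hS r0 z01 w01.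
  rewrite [leRHS]mulrDl; apply: lerD; first exact: ler_wpM2l.
  by rewrite -!mulrA ler_wpM2l// ler_wpM2l// ltW.
exists A => // u Uu; apply: le_trans (uA u Uu) _.
set B := 10 + _ in C'0 *; rewrite -!mulrA ler_wpM2l// ler_wpM2l ?(ltW C'0)//.
have ms : m%:R `^ (s / d%:R) <= 2 `^ s * k%:R `^ s :> R.
  have -> : 2 `^ s * k%:R `^ s = ((2 * k)%N ^ d)%:R `^ (s / d%:R) :> R.
    rewrite natrX -powR_mulrn// -powRrM [d%:R * _]mulrC divfK ?pnatr_eq0 -?lt0n//.
    by rewrite natrM powRM.
  apply: ge0_ler_powR; [exact: divr_ge0|by rewrite nnegrE|by rewrite nnegrE|].
  rewrite ler_nat.
  apply: leq_trans (ltnW mk) _; rewrite leq_exp2r//.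
  by rewrite mul2n -addnn -addn1 leq_add2l.
have -> : alpha / (d%:R * (alpha + g)) = s / d%:R.
  by rewrite /s; field; rewrite pnatr_eq0 -lt0n d0 gt_eqF.
rewrite !powRN -ler_pdivrMl ?powR_gt0// -invfM lef_pV2 ?posrE//.
- by rewrite mulr_gt0// powR_gt0.
- by rewrite powR_gt0// ltr0n.
Qed.

(** * From the algorithm to the optimal orders *)

Section error_bounds.
Context {R : realType} {d m : nat} (U : set (ccube R d)) (e : R).
Context (A : ccube R d -> ccube R d) (mA : alg_det m U A).
Context (uA : forall u, U u -> `|A u - u| <= e).

Lemma err_det_m_le : (err_det_m m U (@idfun (ccube R d)) <= e%:E)%E.
Proof.
apply: ge_ereal_inf; eexists; first by exists A.
by apply: ge_ereal_sup => _ [u Uu <-]; rewrite lee_fin uA.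
Qed.

(** A one-point probability space with constant algorithm and constant sample number [m] turns each
    expectation into the deterministic error. *)
Lemma err_mc_m_le : (0 < m)%N ->
  (err_mc_m m U (@idfun (ccube R d)) <= e%:E)%E.
Proof.
move=> m0; move: (\d_tt : probability unit R) => P.
have intP (r : R) : (\int[P]_w r%:E = r%:E)%E.
  by rewrite (integral_cst P measurableT) [X in (_ * X)%E]probability_setT mule1.
apply: (@le_trans _ _ (ereal_sup
    [set \int[P]_w `|idfun u - A u|%:E | u in U]))%E.
  apply: ereal_inf_lbound; exists _, unit, P, (fun=> A), (fun=> m); split=> //.
  split=> //.
  by rewrite intP.
apply: ge_ereal_sup => _ [u Uu <-].
by rewrite intP lee_fin distrC uA.
Qed.

End error_bounds.

Lemma le_decay_order (R : realType) (err : nat -> \bar R) (beta C : R) :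
  0 <= beta -> 0 < C ->
  (forall m, (0 < m)%N -> (err m <= (C * m%:R `^ (- beta))%:E)%E) ->
  (beta%:E <= decay_order err)%E.
Proof.
by move=> b0 C0 errC; apply: ereal_sup_ubound; exists beta => //; split=> //; exists C.
Qed.

(** The infimum [gamma_sharp] need not be admissible. Solving the bound for [g] gives a lower bound
    common to all admissible exponents, which passes to the infimum and is then solved back. *)
Lemma gamma_sharp_limit (R : realType) (l c : nat -> \bar R) (d : nat)
    (alpha : R) (e : \bar R) : (0 < d)%N -> 0 < alpha ->
  (gamma_sharp l c < +oo)%E ->
  (forall g, admissible_order l c g ->
    ((alpha / (d%:R * (alpha + g)))%:E <= e)%E) ->
  ((alpha / (d%:R * (alpha + fine (gamma_sharp l c))))%:E <= e)%E.
Proof.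
move=> d0 a0 gfin ge; have dR : 0 < d%:R :> R by rewrite ltr0n.
have gamma0 : (0 <= gamma_sharp l c)%E.
  by apply: le_ereal_inf_tmp => _ [g [g0 _] <-]; rewrite lee_fin.
have gammaE : gamma_sharp l c = (fine (gamma_sharp l c))%:E.
  by rewrite fineK// ge0_fin_numE.
set G := fine _ in gammaE *.
have G0 : 0 <= G by rewrite fine_ge0.
have /ereal_inf_lt[_ [g adm <-] _] := gfin.
have pos h : 0 <= h -> 0 < alpha / (d%:R * (alpha + h)).
  by move=> h0; rewrite divr_gt0// mulr_gt0// ltr_wpDr.
case: e ge => [r||] ge; rewrite ?leey//; last by have := ge g adm.
have r0 : 0 < r by apply: lt_le_trans (pos g adm.1) _; have := ge g adm.
have ub h : admissible_order l c h -> alpha / (d%:R * r) - alpha <= h.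
  move=> admh; have h0 := admh.1.
  have := ge h admh; rewrite lee_fin ler_pdivrMr; last first.
    by rewrite mulr_gt0// ltr_wpDr.
  by rewrite lerBlDl ler_pdivrMr ?mulr_gt0//; nra.
have : ((alpha / (d%:R * r) - alpha)%:E <= gamma_sharp l c)%E.
  by apply: le_ereal_inf_tmp => _ [h admh <-]; rewrite lee_fin; exact: ub.
rewrite gammaE !lee_fin lerBlDl ler_pdivrMr ?mulr_gt0// => aG.
by rewrite ler_pdivrMr ?mulr_gt0 ?ltr_wpDr//; lra.
Qed.

Theorem theorem4p2 (R : realType) (l c : nat -> \bar R)
    (lN : forall n : nat, (0 < n)%N -> Nbar (l n))
    (cN : forall n : nat, (0 < n)%N -> Nbar (c n))
    (l_nondecreasing :
      forall m n : nat, (0 < m)%N -> (m <= n)%N -> (l m <= l n)%E)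
    (c_nondecreasing :
      forall m n : nat, (0 < m)%N -> (m <= n)%N -> (c m <= c n)%E)
    (d : nat) (d_gt0 : (0 < d)%N) (alpha : R) (alpha_gt0 : 0 < alpha)
    (gamma_fin : (gamma_sharp l c < +oo)%E) :
  ((alpha / (d%:R * (alpha + fine (gamma_sharp l c))))%:E
     <= err_det (approx_ball l c alpha) (@idfun (ccube R d)))%E /\
  ((alpha / (d%:R * (alpha + fine (gamma_sharp l c))))%:E
     <= err_mc (approx_ball l c alpha) (@idfun (ccube R d)))%E.
Proof.
have rate g : admissible_order l c g ->
    0 <= alpha / (d%:R * (alpha + g)) /\
    exists2 C : R, 0 < C & forall m, (0 < m)%N ->
    exists2 A : ccube R d -> ccube R d, alg_det m (approx_ball l c alpha) A &
      forall u, approx_ball l c alpha u ->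
        `|A u - u| <= C * m%:R `^ (- (alpha / (d%:R * (alpha + g)))).
  move=> adm; split; last exact: alg_det_rate.
  by rewrite divr_ge0 ?mulr_ge0 ?addr_ge0 ?(ltW alpha_gt0)//; case: adm.
split; apply: gamma_sharp_limit => // g /rate[b0 [C C0 Cm]].
  apply: le_decay_order b0 C0 _ => m /Cm[A mA uA].
  exact: err_det_m_le mA uA.
apply: le_decay_order b0 C0 _ => m m0; have [A mA uA] := Cm m m0.
exact: err_mc_m_le mA uA m0.
Qed.
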